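(* Let $x,n$ be integers with $2\leq x\leq n$, and let $H$ be a connected $k$-regular graph on $m\geq 2$ vertices. Then the edge corona $B_{x,n}\diamond H$ is antimagic.
   Context: All graphs are simple, finite and undirected. For a graph $G$ with $q$ edges, an antimagic labeling is a bijection $f:E(G)\to\{1,2,\dots,q\}$ such that the vertex sums $w(u)=\sum_{e\ni u} f(e)$ (sum over the edges incident to $u$) are pairwise distinct over all vertices $u\in V(G)$. A graph is antimagic if it admits an antimagic labeling. The bistar graph $B_{x,n}$ is obtained from two vertex-disjoint stars $K_{1,x}$ and $K_{1,n}$ by adding an edge between their centers. For graphs $G$ and $H$, the edge corona $G\diamond H$ is obtained by taking one copy of $G$ and $|E(G)|$ vertex-disjoint copies of $H$, one copy associated to each edge of $G$, and joining both end vertices of the $i$-th edge of $G$ to every vertex of the $i$-th copy of $H$. *)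

(* Defs.v *)
From mathcomp Require Import all_boot.
Set Implicit Arguments.
Unset Strict Implicit.
Unset Printing Implicit Defensive.

Record sgraph := SGraph {
  vertex :> finType;
  adj : rel vertex;
  adj_sym : symmetric adj;
  adj_irrefl : irreflexive adj
}.

Definition edges (G : sgraph) : {set {set G}} :=
  [set e | [exists u, exists v, adj u v && (e == [set u; v])]].

Definition edge (G : sgraph) := {e : {set G} | e \in edges G}.

Definition connected (G : sgraph) : Prop :=
  0 < #|G| /\ forall u v : G, connect (@adj G) u v.

Definition regular (G : sgraph) (k : nat) : Prop :=
  forall u : G, #|[set v | adj u v]| = k.

(* Only the values of f on edges G matter. *)
Definition vertex_sum (G : sgraph) (f : {set G} -> nat) (u : G) : nat :=
  \sum_(e in edges G | u \in e) f e.

Definition antimagic_labeling (G : sgraph) (f : {set G} -> nat) : Prop :=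
  [/\ {in edges G &, injective f},
      forall i, 0 < i <= #|edges G| <-> exists2 e, e \in edges G & f e = i
    & injective (vertex_sum f)].

Definition antimagic (G : sgraph) : Prop :=
  exists f : {set G} -> nat, antimagic_labeling f.

(* The star K_{1,x}: None is the center, Some i are the x leaves. *)
Definition star_adj (x : nat) : rel (option 'I_x) :=
  fun u v => (u == None) != (v == None).

Definition bistar_adj (x n : nat) : rel (option 'I_x + option 'I_n) :=
  fun u v => match u, v with
  | inl a, inl b => star_adj a b
  | inr a, inr b => star_adj a b
  | inl a, inr b => (a == None) && (b == None)
  | inr a, inl b => (a == None) && (b == None)
  end.

Lemma bistar_sym (x n : nat) : symmetric (@bistar_adj x n).
Proof. by case=> [[a|]|[a|]] [[b|]|[b|]]. Qed.

Lemma bistar_irrefl (x n : nat) : irreflexive (@bistar_adj x n).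
Proof. by case=> [[a|]|[a|]]. Qed.

Definition bistar (x n : nat) : sgraph :=
  SGraph (@bistar_sym x n) (@bistar_irrefl x n).

(* inr (e, h) is the vertex h in the copy of H associated to the edge e. *)
Definition corona_adj (G H : sgraph) : rel (G + edge G * H) :=
  fun a b => match a, b with
  | inl u, inl v => adj u v
  | inl u, inr (e, _) => u \in val e
  | inr (e, _), inl u => u \in val e
  | inr (e, h), inr (e', h') => (e == e') && adj h h'
  end.

Lemma corona_sym (G H : sgraph) : symmetric (@corona_adj G H).
Proof.
case=> [u|[e h]] [v|[e' h']] //=; first exact: adj_sym.
by rewrite eq_sym adj_sym.
Qed.

Lemma corona_irrefl (G H : sgraph) : irreflexive (@corona_adj G H).
Proof. by case=> [u|[e h]] /=; rewrite adj_irrefl ?andbF. Qed.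

Definition edge_corona (G H : sgraph) : sgraph :=
  SGraph (@corona_sym G H) (@corona_irrefl G H).

(* Main.v *)
Require Import Defs.
From mathcomp Require Import all_boot.
From mathcomp Require Import zify.
Set Implicit Arguments.
Unset Strict Implicit.
Unset Printing Implicit Defensive.

(* Orient every edge of the bistar: a pendant edge has its leaf as outer end and
   its center as inner end; the central edge has the center of degree x + 1 as
   outer end. Give the smallest labels to the edges inside the copies of H, the
   next ones to the edges joining a copy to the outer end of its base edge, then
   those joining it to the inner end, and the largest ones to the bistar edges.
   Labelling the inner-end edges in the order of the partial sums at the copy
   vertices makes the sums there distinct, and labelling the bistar edges in the
   order of the partial sums at the leaves makes the sums at the leaves distinct.
   If in addition the outer-end labels are spread evenly over the copies, then
   copy vertices < leaves < centers. Finally the pendant edges (with their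
   copies) contributing most to their inner ends are moved to the center with n
   leaves; the central edge then makes the inequality between the two centers
   strict. *)

(** * Ranks on finite types *)

(** By counting, such an [r] is a bijection onto the integers from 0 to [#|T| - 1]. *)
Definition is_rank (T : finType) (r : T -> nat) : Prop :=
  injective r /\ forall t, r t < #|T|.

Lemma enum_rank_is_rank (T : finType) :
  is_rank (fun t : T => enum_rank t : nat).
Proof. by split=> [s t /val_inj/enum_rank_inj|t]; last exact: ltn_ord. Qed.

Lemma exists_monotone_rank (T : finType) (w : T -> nat) :
  exists2 r, is_rank r & forall s t, r s <= r t -> w s <= w t.
Proof.
pose le : rel T := fun s t => w s <= w t.
pose ts := sort le (enum T).
have ts_all t : t \in ts by rewrite mem_sort mem_enum.
have le_tr : transitive le by move=> b a c; apply: leq_trans.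
have le_refl : reflexive le by move=> a; apply: leqnn.
have ts_sorted : sorted le ts by apply: sort_sorted => a b; apply: leq_total.
exists (fun t => index t ts); first split.
- by move=> s t eq_i; apply: (index_inj s (ts_all s) (ts_all t) eq_i).
- by move=> t; rewrite cardE -(size_sort le) index_mem.
- move=> s t.
  exact: sorted_leq_index le_tr le_refl _ ts_sorted s t (ts_all s) (ts_all t).
Qed.

(** For a rank that is monotone in [w], [r s < r t] forces [w s <= w t], so [w + r] increases
    strictly along [r]. *)
Lemma exists_injective_add_rank (T : finType) (w : T -> nat) :
  exists2 r, is_rank r & injective (fun t => w t + r t).
Proof.
have [r [r_inj r_lt] r_mono] := exists_monotone_rank w.
exists r => // s t wr_eq; apply: r_inj.
have := r_mono s t; have := r_mono t s.
by case: (ltngtP (r s) (r t)) => //; lia.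
Qed.

(* The first and the last entry of row i are i and p m - 1 - i, so the sum of
   every row reaches p m - 1. *)
Lemma exists_row_balanced_rank (P H : finType) : 1 < #|H| ->
  exists2 r : P * H -> nat, is_rank r &
    forall i, (#|P| * #|H|).-1 <= \sum_h r (i, h).
Proof.
move=> H_gt1; set p := #|P|; set m := #|H|.
pose c (i : P) (h : H) := let a := enum_rank i : nat in
  if (enum_rank h : nat) == m.-1 then p.-1 - a else a.
have a_lt (i : P) : enum_rank i < p by exact: ltn_ord.
have c_lt (i : P) (h : H) : c i h < p.
  by have := a_lt i; rewrite /c; case: ifP => _; lia.
exists (fun u => enum_rank u.2 * p + c u.1 u.2); first split.
- move=> [i h] [j h'] /= eq_r.
  have p_gt0 : 0 < p by have := a_lt i; lia.
  have /val_inj/enum_rank_inj eq_h : (enum_rank h : nat) = enum_rank h'.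
    have /(congr1 (divn^~ p)) := eq_r.
    by rewrite !divnMDl // !divn_small ?c_lt // !addn0.
  subst h'; have {eq_r} : c i h = c j h by move/addnI: eq_r.
  have := a_lt i; have := a_lt j; rewrite /c.
  by case: ifP => _ ? ? ?; congr pair; apply/enum_rank_inj/ord_inj; lia.
- move=> [i h]; rewrite card_prod /= -/p -/m.
  have := ltn_ord (enum_rank h); have := c_lt i h.
  by move: (c _ _) (nat_of_ord _) => a b; rewrite -/m; nia.
- move=> i.
  have m_gt0 : 0 < m by rewrite /m; lia.
  have lt_m1 : m.-1 < m by lia.
  pose h0 : H := enum_val (Ordinal m_gt0).
  pose h1 : H := enum_val (Ordinal lt_m1).
  have h01 : h0 != h1.
    by apply/eqP => /enum_val_inj [] /=; rewrite /m; lia.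
  rewrite (bigD1 h0) //= (bigD1 h1) 1?eq_sym //= addnA.
  apply: leq_trans (leq_addr _ _).
  rewrite /c !enum_valK /= mul0n add0n eqxx.
  have := a_lt i; case: eqP; rewrite -/m; first by rewrite /m; lia.
  move: (nat_of_ord _) => a; rewrite /m => _; nia.
Qed.

Lemma is_rank_lt_prod (S T : finType) (r : S * T -> nat) :
  is_rank r -> forall t, r t < #|S| * #|T|.
Proof. by case=> _ r_lt t; rewrite -card_prod. Qed.

(** * Labels and weights *)

Section Labels.

Variables (P F H : finType) (inc : H -> pred F).
Variables (rE : P -> nat) (rF : P * F -> nat) (rA rB : P * H -> nat).

(* P indexes the edges of the base graph and F those of H; A and B stand for the
   edges joining a vertex of a copy to the outer and to the inner end of the base
   edge. *)
Definition labelF t := (rF t).+1.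
Definition labelA t := (#|P| * #|F| + rA t).+1.
Definition labelB t := (#|P| * #|F| + #|P| * #|H| + rB t).+1.
Definition labelE i :=
  (#|P| * #|F| + #|P| * #|H| + #|P| * #|H| + rE i).+1.

Definition label (t : P + P * F + P * H + P * H) : nat :=
  match t with
  | inl (inl (inl i)) => labelE i
  | inl (inl (inr t)) => labelF t
  | inl (inr t) => labelA t
  | inr t => labelB t
  end.

(** The vertex sum at a copy vertex, [inc h f] meaning that [h] is an end of the edge [f] of H. *)
Definition copy_weight (u : P * H) :=
  \sum_(f | inc u.2 f) labelF (u.1, f) + labelA u + labelB u.
(** The vertex sum at the outer end of [i] when that end is a leaf of the base graph. *)
Definition outer_weight i := labelE i + \sum_h labelA (i, h).
(** The joint contribution of a base edge and its copy to the inner end. *)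
Definition inner_weight i := labelE i + \sum_h labelB (i, h).

Hypotheses (rkE : is_rank rE) (rkF : is_rank rF).
Hypotheses (rkA : is_rank rA) (rkB : is_rank rB).

Lemma label_inj : injective label.
Proof.
have [E_inj E_lt] := rkE; have [F_inj _] := rkF.
have [A_inj _] := rkA; have [B_inj _] := rkB.
have F_lt := is_rank_lt_prod rkF; have A_lt := is_rank_lt_prod rkA.
have B_lt := is_rank_lt_prod rkB.
move=> [[[i|t]|t]|t] [[[j|s]|s]|s] /=;
  rewrite /labelE /labelF /labelA /labelB => eq_l.
all: try by [congr (inl (inl (inl _))); apply: E_inj; lia
           | congr (inl (inl (inr _))); apply: F_inj; lia
           | congr (inl (inr _)); apply: A_inj; lia
           | congr (inr _); apply: B_inj; lia].
all: try have := E_lt i; try have := E_lt j.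
all: try have := F_lt t; try have := F_lt s.
all: try have := A_lt t; try have := A_lt s.
all: try have := B_lt t; try have := B_lt s.
all: lia.
Qed.

Lemma label_bound t : 0 < label t <= #|{: P + P * F + P * H + P * H}|.
Proof.
have [_ E_lt] := rkE; have F_lt := is_rank_lt_prod rkF.
have A_lt := is_rank_lt_prod rkA; have B_lt := is_rank_lt_prod rkB.
rewrite !card_sum !card_prod; case: t => [[[i|t]|t]|t]; rewrite /label.
- by have := E_lt i; rewrite /labelE; lia.
- by have := F_lt t; rewrite /labelF; lia.
- by have := A_lt t; rewrite /labelA; lia.
- by have := B_lt t; rewrite /labelB; lia.
Qed.

Lemma labelA_lt_labelB s t : labelA s < labelB t.
Proof. by have := is_rank_lt_prod rkA s; rewrite /labelA /labelB; lia. Qed.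

Lemma sum_labelA_lt_labelB i j : 0 < #|H| ->
  \sum_h labelA (i, h) < \sum_h labelB (j, h).
Proof.
move=> /card_gt0P [h0 _]; rewrite (bigD1 h0) // [ltnRHS](bigD1 h0) //=.
rewrite -addSn leq_add ?labelA_lt_labelB // leq_sum // => h _.
exact/ltnW/labelA_lt_labelB.
Qed.

(** The values of [labelE] lie in an interval of length [#|P|] whose lower bound is already at least
    [#|P|]. *)
Lemma labelE_lt_add i j l : 0 < #|H| -> labelE i < labelE j + labelE l.
Proof.
move=> H_gt0; have [_ /(_ i)] := rkE; rewrite /labelE.
have : #|P| <= #|P| * #|H| by rewrite leq_pmulr.
by lia.
Qed.

(* An outer vertex sees m labels labelA and one labelE; a vertex of a copy sees
   at most m - 1 labels labelF, one labelA and one labelB. *)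
Lemma copy_lt_outer u i :
  (forall h, #|inc h| < #|H|) -> (#|P| * #|H|).-1 <= \sum_h rA (i, h) ->
  copy_weight u < outer_weight i.
Proof.
move=> inc_lt rA_sum; have F_lt := is_rank_lt_prod rkF.
have := is_rank_lt_prod rkA u; have := is_rank_lt_prod rkB u.
rewrite /copy_weight /outer_weight /labelA /labelB /labelE.
set q := #|P| * #|F| => lt_B lt_A.
have sumF : \sum_(f | inc u.2 f) labelF (u.1, f) <= #|inc u.2| * q.
  rewrite -sum_nat_const leq_sum // => f _; exact: F_lt.
have sumA : \sum_h (q + rA (i, h)).+1 = #|H| * q.+1 + \sum_h rA (i, h).
  by rewrite -sum_nat_const -big_split; apply: eq_bigr.
(* With [N = #|P| * #|H|], the copy weight is at most [(#|H| + 1) * q + 3 * N], and the outer weight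
   is at least [#|H|] more than this bound. *)
have := leq_mul (inc_lt u.2) (leqnn q); rewrite sumA mulSn mulnS.
have := inc_lt u.2; lia.
Qed.

End Labels.

Lemma exists_labels (P F H : finType) (inc : H -> pred F) :
  1 < #|H| -> (forall h, #|inc h| < #|H|) ->
  exists rE rF rA rB,
    [/\ @is_rank P rE, @is_rank (P * F)%type rF, is_rank rA & is_rank rB] /\
    [/\ injective (copy_weight inc rF rA rB), injective (outer_weight F rE rA)
      & forall u i, copy_weight inc rF rA rB u < outer_weight F rE rA i].
Proof.
move=> H_gt1 inc_lt.
have [rA rkA rA_sum] := exists_row_balanced_rank P H_gt1.
pose rF (t : P * F) : nat := enum_rank t.
have rkF : is_rank rF := enum_rank_is_rank _.
have [rB rkB B_inj] := exists_injective_add_rank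
  (fun u : P * H => \sum_(f | inc u.2 f) labelF rF (u.1, f) + labelA F rA u).
have [rE rkE E_inj] := exists_injective_add_rank
  (fun i : P => \sum_h labelA F rA (i, h)).
exists rE, rF, rA, rB; do 2!split=> //.
(* [labelB] and [labelE] are [rB] and [rE] up to additive constants. *)
- move=> u v eq_w; apply: B_inj; move: eq_w.
  by rewrite /copy_weight /labelB /=; lia.
- move=> i j eq_w; apply: E_inj; move: eq_w.
  by rewrite /outer_weight /labelE /=; lia.
- by move=> u i; apply: copy_lt_outer.
Qed.

Lemma exists_sorting_bij (x n : nat) (w : 'I_x + 'I_n -> nat) :
  exists2 s : 'I_x + 'I_n -> 'I_x + 'I_n, injective s &
    forall i j, w (s (inl i)) <= w (s (inr j)).
Proof.
have [r [r_inj r_lt] r_mono] := exists_monotone_rank w.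
have card_xn : #|{: 'I_x + 'I_n}| = x + n by rewrite card_sum !card_ord.
have r_lt' t : r t < x + n by rewrite -card_xn.
pose r' t := Ordinal (r_lt' t).
have r'_inj : injective r' by move=> s t /(congr1 val) /r_inj.
have r'_onto k : k \in codom r'.
  by apply: inj_card_onto; rewrite // card_xn card_ord.
(* [unsplit] numbers the left slots before the right ones; the slot numbered [k] receives the
   element of rank [k]. *)
exists (fun t => iinv (r'_onto (unsplit t))).
  move=> s t /(congr1 r'); rewrite !f_iinv => /(congr1 (@split _ _)).
  by rewrite !unsplitK.
have r_iinv k : r (iinv (r'_onto k)) = k.
  by rewrite -[LHS]/(val (r' _)) f_iinv.
by move=> i j; apply: r_mono; rewrite !r_iinv /=; have := ltn_ord i; lia.
Qed.

(** Lets the edges be indexed by a convenient type [E], so that labels need not be defined on sets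
    of vertices. *)
Lemma antimagic_of_presentation (G : sgraph) (E : finType)
    (phi : E -> {set G}) (g : E -> nat) :
  injective phi -> (forall e, (e \in edges G) = (e \in codom phi)) ->
  injective g -> (forall t, 0 < g t <= #|E|) ->
  injective (fun u => \sum_(t | u \in phi t) g t) -> antimagic G.
Proof.
move=> phi_inj phi_edges g_inj g_bound sum_inj.
pose f e := if [pick t | phi t == e] is Some t then g t else 0.
have f_phi t : f (phi t) = g t.
  rewrite /f; case: pickP => [s /eqP/phi_inj -> //|/(_ t)].
  by rewrite eqxx.
have edgesE : edges G = [set phi t | t in E].
  apply/setP=> e; rewrite phi_edges.
  by apply/codomP/imsetP => [[t ->]|[t _ ->]]; exists t.
have card_edges : #|edges G| = #|E| by rewrite edgesE card_imset.
exists f; split.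
- move=> e1 e2; rewrite !phi_edges => /codomP[t1 ->] /codomP[t2 ->].
  by rewrite !f_phi => /g_inj ->.
- move=> i; split=> [|[e]]; last first.
    by rewrite phi_edges => /codomP[t ->]; rewrite f_phi card_edges => <-.
  rewrite card_edges; case: i => // i /= i_lt.
  (* Shifted down by one, [g] injects [E] into the ordinals below [#|E|], hence is onto. *)
  have g_lt t : (g t).-1 < #|E| by case/andP: (g_bound t); lia.
  pose g' t := Ordinal (g_lt t).
  have g'_inj : injective g'.
    move=> s t /(congr1 val) /= eq_g; apply: g_inj.
    by have := g_bound s; have := g_bound t; lia.
  have /codomP[t /(congr1 val) /= eq_i] : Ordinal i_lt \in codom g'.
    by apply: inj_card_onto; rewrite ?card_ord.
  exists (phi t); first by rewrite phi_edges codom_f.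
  by rewrite f_phi; have := g_bound t; lia.
- move=> u v eq_w; apply: sum_inj; move: eq_w; rewrite /vertex_sum.
  have sumE w : \sum_(e in edges G | w \in e) f e = \sum_(t | w \in phi t) g t.
    rewrite edgesE big_mkcondr big_imset /=; last by move=> s t _ _ /phi_inj.
    by rewrite -big_mkcondr; apply: eq_bigr => t _; rewrite f_phi.
  by rewrite !sumE.
Qed.

Lemma edgesP (G : sgraph) (e : {set G}) :
  reflect (exists u v, adj u v /\ e = [set u; v]) (e \in edges G).
Proof.
rewrite inE; apply: (iffP existsP) => [[u /existsP[v /andP[uv /eqP->]]]|].
  by exists u, v.
case=> u [v [uv ->]]; exists u; apply/existsP; exists v.
by rewrite uv eqxx.
Qed.

Lemma adj_edge (G : sgraph) (u v : G) : adj u v -> [set u; v] \in edges G.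
Proof. by move=> uv; apply/edgesP; exists u, v. Qed.

Definition edge_of_adj (G : sgraph) (u v : G) (uv : adj u v) : edge G :=
  Sub [set u; v] (adj_edge uv).

(** * Edges and vertex sums of an edge corona *)

Section Corona.

Variables (G H : sgraph) (P : finType) (outer inner : P -> G).
Let ends i : {set G} := [set outer i; inner i].
Hypothesis ends_inj : injective ends.
Hypothesis ends_adj : forall i, adj (outer i) (inner i).
Hypothesis ends_onto : forall u v, adj u v -> exists i, [set u; v] = ends i.

Definition edge_of i : edge G := edge_of_adj (ends_adj i).

Lemma edge_of_inj : injective edge_of.
Proof. by move=> i j /(congr1 val) /ends_inj. Qed.

Lemma edge_of_onto (e : edge G) : exists i, e = edge_of i.
Proof.
have /edgesP[u [v [/ends_onto[i eq_i] eq_e]]] := valP e.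
by exists i; apply: val_inj; rewrite eq_e eq_i.
Qed.

Local Notation C := (edge_corona G H).

(** The summands come in the same order as in [label]. Taking an image in the second case avoids
    choosing ends for [f]. *)
Definition corona_presentation (t : P + P * edge H + P * H + P * H) : {set C} :=
  match t with
  | inl (inl (inl i)) => [set inl (outer i); inl (inner i)]
  | inl (inl (inr (i, f))) => [set inr (edge_of i, h) | h in val f]
  | inl (inr (i, h)) => [set inl (outer i); inr (edge_of i, h)]
  | inr (i, h) => [set inl (inner i); inr (edge_of i, h)]
  end.

Lemma inl_in_presentation v t :
  ((inl v : C) \in corona_presentation t) =
  match t with
  | inl (inl (inl i)) => v \in ends i
  | inl (inl (inr _)) => false
  | inl (inr u) => v == outer u.1
  | inr u => v == inner u.1
  end.
Proof.
case: t => [[[i|[i f]]|[i h]]|[i h]] /=.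
- by rewrite !inE.
- by apply/imsetP; case.
- by rewrite !inE orbF.
- by rewrite !inE orbF.
Qed.

Lemma inr_in_presentation j h t :
  ((inr (edge_of j, h) : C) \in corona_presentation t) =
  match t with
  | inl (inl (inl i)) => false
  | inl (inl (inr u)) => (u.1 == j) && (h \in val u.2)
  | inl (inr u) => u == (j, h)
  | inr u => u == (j, h)
  end.
Proof.
have pairE i h' : ((inr (edge_of j, h) : C) == inr (edge_of i, h')) =
                  ((i, h') == (j, h)).
  rewrite -[LHS]/((edge_of j == edge_of i) && (h == h')).
  by rewrite (inj_eq edge_of_inj) xpair_eqE eq_sym [h == _]eq_sym.
case: t => [[[i|[i f]]|[i h']]|[i h']] /=.
- by rewrite !inE.
- apply/imsetP/andP=> [[h' h'f [/ends_inj -> ->]]|[/eqP-> hf]] //.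
  by exists h.
- by rewrite !inE -pairE.
- by rewrite !inE -pairE.
Qed.

Lemma corona_presentation_inj : injective corona_presentation.
Proof.
have ends_neq i : outer i <> inner i.
  by move=> eq_i; have := ends_adj i; rewrite eq_i adj_irrefl.
have edge_neq0 (f : edge H) : exists h, h \in val f.
  by have /edgesP[u [v [_ ->]]] := valP f; exists u; rewrite set21.
move=> s t eq_st.
have inlE v : ((inl v : C) \in corona_presentation s) =
              (inl v \in corona_presentation t) by rewrite eq_st.
have inrE j h : ((inr (edge_of j, h) : C) \in corona_presentation s) =
                (inr (edge_of j, h) \in corona_presentation t).
  by rewrite eq_st.
clear eq_st; move: s t inlE inrE.
move=> [[[i|[i f]]|[i h]]|[i h]] [[[j|[j f']]|[j h']]|[j h']] inlE inrE.
(* An edge is recognized by the vertices it contains; a single test vertex settles most of the mixed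
   cases. *)
all: try by have := inlE (outer i); rewrite !inl_in_presentation ?set21 ?eqxx.
all: try by have := inlE (outer j); rewrite !inl_in_presentation ?set21 ?eqxx.
all: try by have := inlE (inner i); rewrite !inl_in_presentation ?set22 ?eqxx.
all: try by have := inlE (inner j); rewrite !inl_in_presentation ?set22 ?eqxx.
all: try by have := inrE i h; rewrite !inr_in_presentation eqxx.
all: try by have := inrE j h'; rewrite !inr_in_presentation eqxx.
- do 3!congr inl; apply: ends_inj; apply/setP=> v.
  by have := inlE v; rewrite !inl_in_presentation.
- have [h hf] := edge_neq0 f.
  have := inrE i h; rewrite !inr_in_presentation /= eqxx hf.
  case/esym/andP=> /eqP eq_ji _; rewrite eq_ji in inrE *.
  suff -> : f = f' by [].
  apply/val_inj/setP=> h'.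
  by have := inrE i h'; rewrite !inr_in_presentation /= eqxx.
- have := inrE i h; rewrite !inr_in_presentation eqxx.
  by move=> /esym/eqP ->.
(* An outer against an inner joining edge: the copy vertex gives [j = i], and then
   [outer i = inner i], which is impossible for adjacent vertices. *)
- have := inrE i h; rewrite !inr_in_presentation eqxx => /esym/eqP[eq_ji _].
  have := inlE (outer i); rewrite !inl_in_presentation /= eq_ji eqxx.
  by move/esym/eqP/ends_neq.
- have := inrE i h; rewrite !inr_in_presentation eqxx => /esym/eqP[eq_ji _].
  have := inlE (outer i); rewrite !inl_in_presentation /= eq_ji eqxx.
  by move/eqP/ends_neq.
- have := inrE i h; rewrite !inr_in_presentation eqxx.
  by move=> /esym/eqP ->.
Qed.

Lemma corona_presentation_edges e :
  (e \in edges C) = (e \in codom corona_presentation).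
Proof.
apply/edgesP/codomP => [[a [b [ab ->]]]|[[[[i|[i f]]|[i h]]|[i h]] ->]] /=.
- have mixed (v : G) (f : edge G) (h : H) : v \in val f -> exists t,
      [set (inl v : C); (inr (f, h) : C)] = corona_presentation t.
    have [i ->] := edge_of_onto f; rewrite !inE => /orP[] /eqP->.
      by exists (inl (inr (i, h))).
    by exists (inr (i, h)).
  case: a b ab => [u|[f h]] [v|[f' h']] /=.
  + move=> /ends_onto[i eq_i]; exists (inl (inl (inl i))) => /=.
    by rewrite -!imset_set1 -imsetU eq_i imsetU !imset_set1.
  + exact: mixed.
  + by rewrite setUC; apply: mixed.
  + case/andP=> /eqP <- hh'; have [i ->] := edge_of_onto f.
    exists (inl (inl (inr (i, edge_of_adj hh')))) => /=.
    by rewrite imsetU !imset_set1.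
- by exists (inl (outer i)), (inl (inner i)); split; first exact: ends_adj.
- have /edgesP[h [h' [hh' ->]]] := valP f.
  exists (inr (edge_of i, h)), (inr (edge_of i, h')).
  by rewrite /= eqxx hh' imsetU !imset_set1.
- by exists (inl (outer i)), (inr (edge_of i, h)); rewrite /= set21.
- by exists (inl (inner i)), (inr (edge_of i, h)); rewrite /= set22.
Qed.

Variables (rE : P -> nat) (rF : P * edge H -> nat) (rA rB : P * H -> nat).

Lemma sum_label_inl v :
  \sum_(t | (inl v : C) \in corona_presentation t) label rE rF rA rB t =
  \sum_(i | v \in ends i) labelE (edge H) H rE i
  + \sum_(i | v == outer i) \sum_h labelA (edge H) rA (i, h)
  + \sum_(i | v == inner i) \sum_h labelB (edge H) rB (i, h).
Proof.
rewrite (eq_bigl _ _ (inl_in_presentation v)) !big_sumType /=.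
rewrite [X in _ + X + _ + _]big_pred0 // addn0.
have flatten (p : pred P) (F : P * H -> nat) :
    \sum_(u | p u.1) F u = \sum_(i | p i) \sum_h F (i, h).
  rewrite pair_big /=; apply: eq_big => [u|[i h] //].
  by rewrite andbT.
congr (_ + _ + _); first exact: (flatten (fun i => v == outer i)).
exact: (flatten (fun i => v == inner i)).
Qed.

Lemma sum_label_inr j h :
  \sum_(t | (inr (edge_of j, h) : C) \in corona_presentation t)
    label rE rF rA rB t =
  copy_weight (fun h' (f : edge H) => h' \in val f) rF rA rB (j, h).
Proof.
rewrite (eq_bigl _ _ (inr_in_presentation j h)) !big_sumType /=.
rewrite big_pred0 // add0n !big_pred1_eq /copy_weight /=.
congr (_ + _ + _).
rewrite (reindex_onto (pair j) snd) /=; last by move=> [i f] /andP[/eqP /= <-].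
by apply: eq_bigl => f; rewrite !eqxx andbT.
Qed.

End Corona.

(** An edge at [h] is determined by its other end, one of the [#|H| - 1] vertices different from
    [h]. *)
Lemma edges_at_lt (H : sgraph) (h : H) :
  #|[pred f : edge H | h \in val f]| < #|H|.
Proof.
have -> : #|H| = #|predC1 h|.+1.
  by rewrite (cardC1 h) prednK //; apply/card_gt0P; exists h.
rewrite ltnS -(card_image val_inj).
apply: leq_trans (leq_image_card (fun v => [set h; v]) _).
apply/subset_leq_card/subsetP => e /imageP[f hf ->].
have /edgesP[u [v [uv eq_f]]] := valP f; move: hf; rewrite inE eq_f => huv.
have neq_uv : u != v by apply/eqP=> eq_uv; rewrite eq_uv adj_irrefl in uv.
case/set2P: huv => ->.
  by apply/imageP; exists v; rewrite // !inE eq_sym.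
by apply/imageP; exists u; rewrite 1?setUC ?inE.
Qed.

Lemma big_option (T : finType) (p : pred (option T)) (F : option T -> nat) :
  \sum_(i | p i) F i =
  (if p None then F None else 0) + \sum_(t | p (Some t)) F (Some t).
Proof.
rewrite (bigID (pred1 None)) /=; congr (_ + _).
  case pN: (p None).
    by rewrite (big_pred1 None) // => -[t|] //=; rewrite ?andbF ?pN.
  by rewrite big_pred0 // => -[t|]; rewrite ?andbF ?pN.
rewrite (reindex_omap Some id); last by case=> [t|] //; rewrite andbF.
by apply: eq_bigl => t; rewrite eqxx !andbT.
Qed.

(** * The oriented bistar *)

Section BistarEnds.

Variables x n : nat.

(* None is the edge joining the two centers. *)
Definition bistar_outer (i : option ('I_x + 'I_n)) : bistar x n :=
  match i with
  | Some (inl a) => inl (Some a)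
  | Some (inr b) => inr (Some b)
  | None => inl None
  end.

Definition bistar_inner (i : option ('I_x + 'I_n)) : bistar x n :=
  match i with
  | Some (inl _) => inl None
  | _ => inr None
  end.

Lemma bistar_ends_inj :
  injective (fun i => [set bistar_outer i; bistar_inner i]).
Proof.
move=> i j /= /setP eq_ends.
(* Outer ends suffice: of two distinct edges one is pendant, and its leaf is not on the other. *)
have := eq_ends (bistar_outer i); have := eq_ends (bistar_outer j).
rewrite !set21 !inE; clear eq_ends; move: i j.
move=> [[a|b]|] [[a'|b']|] //= /orP oj /esym/orP oi.
all: by [case: oi => /eqP // -[->] | case: oj => /eqP // -[->]].
Qed.

Lemma bistar_ends_adj i : adj (bistar_outer i) (bistar_inner i).
Proof. by case: i => [[]|]. Qed.

Lemma bistar_ends_onto u v : @adj (bistar x n) u v ->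
  exists i, [set u; v] = [set bistar_outer i; bistar_inner i].
Proof.
case: u v => [[a|]|[b|]] [[a'|]|[b'|]] //= _.
- by exists (Some (inl a)).
- by exists (Some (inl a')); rewrite setUC.
- by exists None.
- by exists (Some (inr b)).
- by exists None; rewrite setUC.
- by exists (Some (inr b')); rewrite setUC.
Qed.

End BistarEnds.

(** Precomposing all ranks with one permutation of the base edges only permutes the weights, so the
    earlier properties survive; [omap s] fixes the central edge. *)
Lemma exists_sorted_labels (x n : nat) (F H : finType) (inc : H -> pred F) :
  1 < #|H| -> (forall h, #|inc h| < #|H|) ->
  let P := option ('I_x + 'I_n) in
  exists rE rF rA rB,
    [/\ @is_rank P rE, @is_rank (P * F)%type rF, is_rank rA & is_rank rB] /\
    [/\ injective (copy_weight inc rF rA rB), injective (outer_weight F rE rA),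
        forall u i, copy_weight inc rF rA rB u < outer_weight F rE rA i
      & forall a b, inner_weight F rE rB (Some (inl a)) <=
                    inner_weight F rE rB (Some (inr b))].
Proof.
move=> H_gt1 inc_lt P.
have [rE [rF [rA [rB [[rkE rkF rkA rkB] [copy_inj outer_inj lt_co]]]]]] :=
  exists_labels P H_gt1 inc_lt.
have [s s_inj s_sorts] :=
  exists_sorting_bij (fun l => inner_weight F rE rB (Some l)).
have t_inj : injective (omap s) := inj_omap s_inj.
pose t2 T (u : P * T) := (omap s u.1, u.2).
have t2_inj T : injective (t2 T) by move=> [i y] [j z] [/t_inj -> ->].
have rank_comp (T : finType) (t : T -> T) r :
    injective t -> is_rank r -> is_rank (r \o t).
  by move=> inj_t [r_inj r_lt]; split=> [|y]; [apply: inj_comp | apply: r_lt].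
exists (rE \o omap s), (rF \o t2 _), (rA \o t2 _), (rB \o t2 _).
split; split.
- exact: rank_comp.
- by apply: rank_comp => //; apply: t2_inj.
- by apply: rank_comp => //; apply: t2_inj.
- by apply: rank_comp => //; apply: t2_inj.
- by move=> u v /(copy_inj (t2 _ u) (t2 _ v)) /t2_inj.
- by move=> i j /(outer_inj (omap s i) (omap s j)) /t_inj.
- by move=> u i; apply: (lt_co (t2 _ u) (omap s i)).
- exact: s_sorts.
Qed.

(** * Comparison of the vertex sums in the corona of the bistar *)

Theorem theorem3p2 (x n : nat) (H : sgraph) (k m : nat)
  (hx : 2 <= x) (hxn : x <= n)
  (hconn : connected H) (hreg : regular H k)
  (hcard : #|H| = m) (hm : 2 <= m) :
  antimagic (edge_corona (bistar x n) H).
Proof.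
have H_gt1 : 1 < #|H| by rewrite hcard.
have H_gt0 : 0 < #|H| by apply: ltnW.
have [rE [rF [rA [rB [[rkE rkF rkA rkB] [copy_inj outer_inj lt_co sorted_i]]]]]]
  := exists_sorted_labels x n H_gt1 (@edges_at_lt H).
have ends_inj := @bistar_ends_inj x n.
have ends_adj := @bistar_ends_adj x n.
have ends_onto := @bistar_ends_onto x n.
apply: (antimagic_of_presentation
  (@corona_presentation_inj _ H _ _ _ ends_inj ends_adj)
  (@corona_presentation_edges _ H _ _ _ ends_adj ends_onto)
  (label_inj rkE rkF rkA rkB) (label_bound rkE rkF rkA rkB)).
set S := fun u => _.
have S_copy j h : S (inr (edge_of ends_adj j, h)) =
    copy_weight (fun h (f : edge H) => h \in val f) rF rA rB (j, h).
  exact: sum_label_inr.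
have S_leaf l : S (inl (bistar_outer (Some l))) =
    outer_weight (edge H) rE rA (Some l).
  rewrite /S sum_label_inl -[RHS]addn0 /outer_weight; congr (_ + _ + _).
  - apply: big_pred1 => i; case: l i => [a|b] [[a'|b']|];
      by rewrite !inE //= ?orbF 1?eq_sym.
  - apply: big_pred1 => i; case: l i => [a|b] [[a'|b']|];
      by rewrite //= 1?eq_sym.
  - by rewrite big_pred0 // => i; case: l i => [a|b] [[a'|b']|].
(* The left center is the outer end of the central edge and the inner end of the [x] left pendant
   edges. *)
have S_left : S (inl (inl None)) =
    labelE (edge H) H rE None + \sum_h labelA (edge H) rA (None, h)
    + \sum_a inner_weight (edge H) rE rB (Some (inl a)).
  rewrite /S sum_label_inl /inner_weight big_split addnACA addnA.
  congr (_ + _ + _).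
  - rewrite big_option big_sumType /= set21 [X in _ + (_ + X)]big_pred0 ?addn0.
      by congr (_ + _); apply: eq_bigl => a; rewrite !inE.
    by move=> b; rewrite !inE.
  - by apply: big_pred1 => -[[a|b]|].
  - by rewrite big_option big_sumType /= [X in _ + (_ + X)]big_pred0 // addn0.
have S_right : S (inl (inr None)) =
    labelE (edge H) H rE None + \sum_h labelB (edge H) rB (None, h)
    + \sum_b inner_weight (edge H) rE rB (Some (inr b)).
  rewrite /S sum_label_inl /inner_weight big_split addnACA.
  rewrite [X in _ + X + _]big_pred0 ?addn0; last by case=> [[a|b]|].
  congr (_ + _).
  - rewrite big_option big_sumType /= set22 big_pred0 ?add0n.
      by congr (_ + _); apply: eq_bigl => b; rewrite !inE.
    by move=> a; rewrite !inE.
  - by rewrite big_option big_sumType /= [X in _ + (X + _)]big_pred0.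
have leaf_lt_left l : S (inl (bistar_outer (Some l))) < S (inl (inl None)).
  have x_gt0 : 0 < x by apply: ltnW.
  (* One left pendant edge is enough: its [labelB] sum beats the [labelA] sum at the leaf, and its
     [labelE] plus the central one beats the [labelE] at the leaf. *)
  pose a0 := Some (inl (Ordinal x_gt0)) : option ('I_x + 'I_n).
  rewrite S_leaf S_left (bigD1 (Ordinal x_gt0)) //= /outer_weight /inner_weight.
  have := labelE_lt_add (edge H) rkE (Some l) None a0 H_gt0.
  have := sum_labelA_lt_labelB (edge H) rB rkA (Some l) a0 H_gt0.
  have arith a b c d e f g : b < e -> a < c + d -> a + b < c + f + (d + e + g).
    by lia.
  exact: arith.
have left_lt_right : S (inl (inl None)) < S (inl (inr None)).
  rewrite S_left S_right -addSn leq_add //.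
    by rewrite ltn_add2l; apply: sum_labelA_lt_labelB.
  pose w b := inner_weight (edge H) rE rB (Some (inr b)).
  (* The left pendant edges are matched with the first [x] right ones; strictness came from the
     central edge. *)
  apply: (@leq_trans (\sum_(a < x) w (widen_ord hxn a))).
    by apply: leq_sum => a _; apply: sorted_i.
  rewrite -(big_ord_narrow hxn) [leqRHS](bigID (fun b : 'I_n => b < x)) /=.
  exact: leq_addr.
have copy_lt_leaf j h l : S (inr (edge_of ends_adj j, h))
    < S (inl (bistar_outer (Some l))).
  by rewrite S_copy S_leaf.
have vertexP (u : edge_corona (bistar x n) H) :
  [\/ exists j h, u = inr (edge_of ends_adj j, h),
    exists l, u = inl (bistar_outer (Some l)), u = inl (inl None)
    | u = inl (inr None)].
  case: u => [[[a|]|[b|]]|[e h]].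
  - by apply: Or42; exists (inl a).
  - exact: Or43.
  - by apply: Or42; exists (inr b).
  - exact: Or44.
  - have [j ->] := edge_of_onto ends_adj ends_onto e.
    by apply: Or41; exists j, h.
(* A fixed leaf, linking copy vertices to the centers in the chain of inequalities. *)
pose l0 : 'I_x + 'I_n := inl (Ordinal (ltnW hx)).
move=> u v.
have [[j [h ->]]|[l ->]|->|->] := vertexP u;
  have [[j' [h' ->]]|[l' ->]|->|->] := vertexP v => // eq_S.
all: try by move: eq_S; rewrite !S_copy => /copy_inj[-> ->].
all: try by move: eq_S; rewrite !S_leaf => /outer_inj[->].
all: have := leaf_lt_left l0; have := left_lt_right.
all: try have := copy_lt_leaf j h l0; try have := copy_lt_leaf j' h' l0.
all: try have := copy_lt_leaf j h l'; try have := copy_lt_leaf j' h' l.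
all: try have := leaf_lt_left l; try have := leaf_lt_left l'.
all: lia.
Qed.
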